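(* Let $k\ge 1$ be an integer and $a>0$ a real number. Let $\lambda$ be a random variable with the gamma distribution $G(1/k,a)$, i.e. with density $$f(\lambda)=\frac{a^{1/k}}{\Gamma(1/k)}e^{-a\lambda}\lambda^{(1/k)-1},\qquad \lambda>0,$$ and let $\{X(t),t\ge0\}$ be a process which, conditionally on $\lambda$, is a Poisson process with rate $\lambda$. Put $Z(t)=kX(t)+1$. Then for every $t\ge 0$, $Z(t)$ follows a Harris distribution, namely $P'_{nk+1}(t)=P(Z(t)=nk+1)$ is given by $$P'_{nk+1}(t)=\binom{(1/k)+n-1}{n}\left(\frac{a}{a+t}\right)^{1/k}\left(\frac{t}{a+t}\right)^n,\qquad n=0,1,2,\ldots$$
   Context: Conditionally on $\lambda$, $P(X(t)=n\mid\lambda)=e^{-\lambda t}(\lambda t)^n/n!$ for $n=0,1,2,\ldots$ Harris distribution: for an integer $k\ge 1$ and real $m>1$, a random variable $X$ has the Harris distribution $H_1(m,k,1/k)$ if $P(X=1+nk)=\binom{(1/k)+n-1}{n}\left(\frac1m\right)^{1/k}\left(1-\frac1m\right)^n$ for $n=0,1,2,\ldots$; its probability generating function is $s/(m-(m-1)s^k)^{1/k}$. Here $\binom{x+n-1}{n}=\frac{x(x+1)\cdots(x+n-1)}{n!}$ is the generalized binomial coefficient. At $t=0$ the formula is read with $0^0=1$ (degenerate case $m=1$). *)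

(* Defs.v *)
From HB Require Import structures.
From mathcomp Require Export all_boot all_order all_algebra.
From mathcomp Require Export all_classical all_reals all_analysis.
Export Order.TTheory GRing.Theory Num.Theory.
Export numFieldNormedType.Exports.

Set Implicit Arguments.
Unset Strict Implicit.
Unset Printing Implicit Defensive.

Local Open Scope classical_set_scope.
Local Open Scope ring_scope.

(* The binomial coefficient "x + n - 1 choose n" for real x. *)
Definition rising_binom (R : realType) (x : R) (n : nat) : R :=
  (\prod_(i < n) (x + i%:R)) / n`!%:R.

(* [Z] has the Harris distribution H_1(m, k, 1/k).  The values 1 + n k carry the
   whole mass, so that these probabilities determine the law. *)
Definition harris (d : measure_display) (T : measurableType d) (R : realType)
    (P : probability T R) (m : R) (k : nat) (Z : T -> nat) : Prop :=
  [/\ (0 < k)%N, 1 < m, measurable_fun [set: T] Z &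
    forall n : nat, P [set w | Z w = (1 + n * k)%N] =
      (rising_binom k%:R^-1 n * m^-1 `^ k%:R^-1 * (1 - m^-1) ^+ n)%:E].

Definition Gamma (R : realType) (z : R) : R :=
  \int[lebesgue_measure]_(x in `]0, +oo[) (x `^ (z - 1) * expR (- x)).

(* Density of the gamma distribution with shape [s] and rate [a]. *)
Definition gamma_pdf (R : realType) (s a : R) : R -> R :=
  (fun x => a `^ s / Gamma s * expR (- a * x) * x `^ (s - 1)) \_ `]0, +oo[.

Definition gamma_distributed (d : measure_display) (T : measurableType d)
    (R : realType) (P : probability T R) (s a : R) (Y : {RV P >-> R}) : Prop :=
  forall B : set R, measurable B ->
    distribution P Y B =
      (\int[lebesgue_measure]_(x in B) (gamma_pdf s a x)%:E)%E.

(* P(E | Y) = g(Y), i.e. g(Y) is a version of the conditional probability of the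
   event [E] given the sigma-algebra generated by [Y]. *)
Definition cond_prob (d : measure_display) (T : measurableType d)
    (R : realType) (P : probability T R) (Y : {RV P >-> R}) (E : set T)
    (g : R -> R) : Prop :=
  measurable_fun [set: R] g /\
  forall B : set R, measurable B ->
    P (E `&` Y @^-1` B) = (\int[P]_(w in Y @^-1` B) (g (Y w))%:E)%E.

(* Unlike [poisson_pmf], which is constantly 1 at r = 0, this is the mass
   function of the point mass at 0 when r = 0. *)
Definition poisson_mass (R : realType) (r : R) (n : nat) : R :=
  expR (- r) * r ^+ n / n`!%:R.

(* Conditionally on [L], [X] is a Poisson process with rate [L]: a counting
   process started at 0 whose increments over successive intervals are,
   given [L], independent and Poisson.  The properties of the paths need not
   mention [L], since an event is almost sure if and only if its conditional
   probability given [L] is almost surely 1.  Only times t >= 0 matter. *)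
Definition cond_poisson_process (d : measure_display) (T : measurableType d)
    (R : realType) (P : probability T R) (L : {RV P >-> R})
    (X : R -> {RV P >-> nat}) : Prop :=
  [/\ {ae P, forall w, X 0 w = 0%N},
      {ae P, forall w, forall s t, 0 <= s -> s <= t -> (X s w <= X t w)%N},
      {ae P, forall w, forall t, 0 <= t ->
        \forall s \near t^'+, X s w = X t w} &
      forall (m : nat) (t : nat -> R) (n : nat -> nat),
        0 <= t 0%N -> (forall i, (i < m)%N -> t i < t i.+1) ->
        cond_prob L
          [set w | forall i, (i < m)%N -> X (t i.+1) w = (X (t i) w + n i)%N]
          (fun l => \prod_(i < m) poisson_mass (l * (t i.+1 - t i)) (n i))].

(* Main.v *)
Require Import Defs.
From HB Require Import structures.
From mathcomp Require Import measurable_realfun ring.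
Set Implicit Arguments.
Unset Strict Implicit.
Unset Printing Implicit Defensive.
Local Open Scope classical_set_scope.
Local Open Scope ring_scope.

(** Write [s = 1/k].  Since [Z t = k X(t) + 1], everything reduces to the law of
    the mixed Poisson variable [X(t)].  Conditioning on the rate and integrating
    against its density gives
    [P(X(t) = n) = c t^n / n! * I(a + t, s + n)], where [c = a^s / Gamma(s)] and
    [I(b, s)] is the integral of [x^(s-1) e^(-bx)] over the positive half-line
    ([gamma_integral]).  Two classical identities evaluate it:
    [I(b, s + 1) = (s / b) I(b, s)] ([gamma_integral_recurrence]) turns the shift
    by [n] into the rising factorial [s (s+1) ... (s+n-1)], and
    [I(b, s) = b^(-s) I(1, s)] ([gamma_integral_scale]) produces the powers of
    [a + t].  What is left is [c I(1, s)], and it equals [a^s] because a gamma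
    law has total mass 1.

    The integrals [I(b, s)] are kept as extended reals: both identities are then
    statements about nonnegative integrals, provable by Tonelli and by monotone
    limits, and the convergence of [I(1, s)] is never an issue, since the total
    mass of the density fixes the only product in which it occurs.

    The passage from the conditional law to an integral against the density
    rests on [ge0_integral_comp_density], obtained from the uniqueness of
    Radon-Nikodym derivatives.  At [t = 0] the process is almost surely 0, and
    the formula is checked directly. *)

(** * Two elementary integrals *)

(** For [s < 1] the integrand is unbounded at 0, so the fundamental theorem of
    calculus is applied on [[x / (n + 2), x]] before letting [n] grow. *)
Lemma integral_powRB1 (R : realType) (s x : R) : 0 < s -> 0 < x ->
  (\int[lebesgue_measure]_(y in `]0%R, x]) (s * y `^ (s - 1))%:E = (x `^ s)%:E)%E.
Proof.
move=> s0 x0; pose e n : R := x / n.+2%:R.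
have e0 n : 0 < e n by rewrite divr_gt0.
have ex n : e n < x by rewrite ltr_pdivrMr// ltr_pMr// ltr1n.
have cov : \bigcup_n [set` `[e n, x]] = `]0, x]%classic.
  apply/seteqP; split => [y [n _]|y]/=; rewrite !in_itv/= => /andP[y0 yx].
    by rewrite yx (lt_le_trans (e0 n)).
  have [n xyn] : exists n : nat, x / y < n%:R.
    by exists (Num.bound (x / y)); rewrite archi_boundP// divr_ge0 ?ltW.
  exists n => //=; rewrite in_itv/= yx andbT ler_pdivrMr// mulrC -ler_pdivrMr//.
  by rewrite (le_trans (ltW xyn))// ler_nat leqW// leqnSn.
have mf D : measurable_fun D (fun y => (s * y `^ (s - 1))%:E).
  by apply/measurable_EFinP/measurable_funTS/measurable_funM.
have f0 y : (0 <= (s * y `^ (s - 1))%:E)%E.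
  by rewrite lee_fin mulr_ge0 ?powR_ge0// ltW.
have nde : {homo (fun n => `[e n, x]%classic) : n m / (n <= m)%N >-> (n <= m)%O}.
  move=> n m nm; rewrite subsetEset => y /=; rewrite !in_itv/= => /andP[y0 ->].
  rewrite andbT (le_trans _ y0)// ler_pM2l// lef_pV2 ?posrE// ler_nat.
  by rewrite !ltnS.
have := @ge0_nondecreasing_set_cvg_integral _ _ R _ _ lebesgue_measure nde
  (fun=> measurable_itv _) (fun=> mf _) (fun _ _ _ => f0 _).
rewrite cov => /cvg_lim <- //; apply/cvg_lim => //.
have cp (r y : R) : 0 < y -> {for y, continuous (@powR R ^~ r)}.
  move=> y0; apply: differentiable_continuous; apply/derivable1_diffP.
  by apply: derivable_powR; rewrite in_itv/= y0.
rewrite (_ : (fun n => _) = (fun n => (x `^ s - e n `^ s)%:E)); last first.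
  apply/funext => n; rewrite EFinB.
  rewrite (@continuous_FTC2 _ _ (fun y : R => y `^ s)) => //.
  - apply: continuous_in_subspaceT => y; rewrite inE/= in_itv/= => /andP[eny _].
    apply: (@continuousM R R (fun=> s) (fun y => y `^ (s-1))); first exact: cst_continuous.
    by apply: cp; rewrite (lt_le_trans _ eny).
  - split.
    + move=> y; rewrite in_itv/= => /andP[eny _].
      by apply: derivable_powR; rewrite in_itv/= (lt_trans _ eny).
    + by apply: cvg_at_right_filter; exact: cp.
    + by apply: cvg_at_left_filter; exact: cp.
  - move=> y; rewrite in_itv/= => /andP[eny _].
    by rewrite powR_derive1// in_itv/= andbT (lt_trans _ eny).
apply: cvg_EFin; first by near=> n.
rewrite -[X in _ --> X]subr0; apply: cvgB; first exact: cvg_cst.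
have ecvg : e n @[n --> \oo] --> 0.
  rewrite -(mulr0 x); apply: cvgM; first exact: cvg_cst.
  by rewrite (cvg_shiftS (@harmonic R)); exact: cvg_harmonic.
by have /cvg_at_rightP := powR_cvg0 s0; apply.
Unshelve. all: by end_near. Qed.

Lemma integral_expR_tail (R : realType) (b y : R) : 0 < b ->
  (\int[lebesgue_measure]_(x in `[y, +oo[) (b * expR (- b * x))%:E =
   (expR (- b * y))%:E)%E.
Proof.
move=> b0.
have c : continuous (fun x : R => expR (- b * x)).
  by move=> x; apply: continuous_comp; [exact: mulrl_continuous|exact: continuous_expR].
rewrite (@ge0_continuous_FTC2y _ _ (fun x => - expR (- b * x)) _ 0).
- by rewrite EFinN oppeK add0e.
- by move=> x _; rewrite mulr_ge0 ?expR_ge0// ltW.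
- apply: continuous_subspaceT => x.
  apply: (@continuousM R R (fun=> b) (fun x => expR (- b * x))); last exact: c.
  exact: cst_continuous.
- rewrite -oppr0; apply: cvgN.
  rewrite (_ : (fun x => expR (- b * x)) =
               (fun z => expR (- z)) \o (fun z => b * z)); last first.
    by apply: eq_fun => x; rewrite mulNr.
  apply: (@cvg_comp _ _ _ _ _ _ (pinfty_nbhs R)); last exact: cvgr_expR.
  exact: gt0_cvgMry.
- by move=> x _; exact: ex_derive.
- by apply: cvgN; apply/cvg_at_right_filter; exact: c.
- move=> x _; rewrite derive1E derive_val/=.
  by rewrite /GRing.scale/=; ring.
Qed.

(** * Euler's integral of the second kind *)

Lemma ge0_integral_EFinZl (R : realType) (D : set R) (k : R) (f : R -> R) :
  measurable D -> measurable_fun D f -> (forall x, D x -> 0 <= f x) -> 0 <= k ->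
  (\int[lebesgue_measure]_(x in D) (k * f x)%:E =
   k%:E * \int[lebesgue_measure]_(x in D) (f x)%:E)%E.
Proof.
move=> mD mf f0 k0; rewrite -ge0_integralZl_EFin//.
exact/measurable_EFinP.
Qed.

(** Euler's integral of the second kind with rate [b], as an extended real so
    that its identities need no convergence hypothesis. *)
Definition gamma_integral (R : realType) (b s : R) : \bar R :=
  (\int[lebesgue_measure]_(x in `]0%R, +oo[) (x `^ (s - 1) * expR (- b * x))%:E)%E.

Lemma measurable_gamma_kernel (R : realType) (b s : R) (D : set R) :
  measurable_fun D (fun x => x `^ (s - 1) * expR (- b * x)).
Proof.
apply/measurable_funTS/measurable_funM => //.
by apply: measurableT_comp => //; exact: measurable_funM.
Qed.

(** Tonelli for the density [s y^(s-1) b e^(-bx)] on the region [0 < y <= x]: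
    integrating over [y] first leaves [b x^s e^(-bx)], integrating over [x]
    first leaves [s y^(s-1) e^(-by)].  Unlike integration by parts, this asks
    for no integrability and no boundary term at 0. *)
Lemma gamma_integral_recurrence (R : realType) (b s : R) : 0 < b -> 0 < s ->
  gamma_integral b (s + 1) = ((s / b)%:E * gamma_integral b s)%E.
Proof.
move=> b0 s0.
suff bs : (b%:E * gamma_integral b (s + 1) = s%:E * gamma_integral b s)%E.
  move: bs; move: (gamma_integral b (s + 1)) (gamma_integral b s) => G' G bs.
  by rewrite (mulrC s) EFinM -muleA -bs muleA -EFinM mulVf ?gt_eqF// mul1e.
have scale (r u : R) : 0 < r -> (r%:E * gamma_integral b u =
    \int[lebesgue_measure]_(x in `]0%R, +oo[)
      (r * (x `^ (u - 1) * expR (- b * x)))%:E)%E.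
  move=> r0; apply/esym/ge0_integral_EFinZl => //.
  - exact: measurable_gamma_kernel.
  - by move=> x _; rewrite mulr_ge0 ?powR_ge0 ?expR_ge0.
  - exact: ltW.
pose h (z : R * R) : R := if (0 < z.2) && (z.2 <= z.1)
  then (s * z.2 `^ (s - 1)) * (b * expR (- b * z.1)) else 0.
have m1 : measurable_fun [set: measurableTypeR R] (fun y : R => s * y `^ (s - 1)).
  exact: measurable_funM.
have m2 : measurable_fun [set: measurableTypeR R] (fun x : R => b * expR (- b * x)).
  by apply: measurable_funM => //; apply: measurableT_comp => //; exact: measurable_funM.
have mh : measurable_fun [set: measurableTypeR R * measurableTypeR R] (EFin \o h).
  apply/measurable_EFinP; apply: measurable_fun_ifT => //.
    apply: measurable_and.
      by apply: measurable_fun_ltr => //; exact: measurable_snd.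
    by apply: measurable_fun_ler; [exact: measurable_snd|exact: measurable_fst].
  apply: measurable_funM.
    exact: (measurableT_comp m1 (@measurable_snd _ _ _ _)).
  exact: (measurableT_comp m2 (@measurable_fst _ _ _ _)).
have h0 z : (0 <= (EFin \o h) z)%E.
  by rewrite lee_fin /h; case: ifP => [_|//]; rewrite !mulr_ge0 ?powR_ge0 ?expR_ge0 ?ltW.
have fub := @fubini_tonelli _ _ _ _ R lebesgue_measure lebesgue_measure _ mh h0.
rewrite (scale _ _ b0) (scale _ _ s0).
transitivity (\int[lebesgue_measure]_x \int[lebesgue_measure]_y (EFin \o h) (x, y))%E.
  rewrite [LHS]integral_mkcond; apply: eq_integral => x _; rewrite patchE.
  case: ifPn => xD.
    have x0 : 0 < x by move: xD; rewrite inE /= in_itv/= andbT.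
    transitivity (\int[lebesgue_measure]_(y in `]0%R, x])
        ((b * expR (- b * x)) * (s * y `^ (s - 1)))%:E)%E.
      rewrite (ge0_integral_EFinZl (f := fun y => s * y `^ (s - 1))).
      - by rewrite (integral_powRB1 s0 x0) addrK -EFinM; congr EFin; ring.
      - exact: measurable_itv.
      - exact: measurable_funTS.
      - by move=> y _; rewrite mulr_ge0 ?powR_ge0 ?ltW.
      - by rewrite mulr_ge0 ?expR_ge0 ?ltW.
    rewrite [LHS]integral_mkcond; apply: eq_integral => y _.
    by rewrite patchE /h/= mem_setE in_itv/=; case: ifP => [_|//]; rewrite mulrC.
  have {}xD : ~~ (0 < x).
    by apply: contra xD => x0; rewrite inE/= in_itv/= x0.
  apply/esym; apply: integral0_eq => y _; rewrite /h/=; case: ifP => [/andP[y0 yx]|_ //].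
  by move/negP : xD; case; exact: lt_le_trans yx.
rewrite fub [RHS]integral_mkcond; apply: eq_integral => y _; rewrite patchE.
case: ifPn => yD.
  have y0 : 0 < y by move: yD; rewrite inE /= in_itv/= andbT.
  transitivity (\int[lebesgue_measure]_(x in `[y, +oo[)
        ((s * y `^ (s - 1)) * (b * expR (- b * x)))%:E)%E.
    rewrite [RHS]integral_mkcond; apply: eq_integral => x _.
    by rewrite patchE /h/= mem_setE in_itv/= y0 andbT/=; case: ifP.
  rewrite (ge0_integral_EFinZl (f := fun x => b * expR (- b * x))).
  - by rewrite (integral_expR_tail y b0) -EFinM mulrA.
  - exact: measurable_itv.
  - exact: measurable_funTS.
  - by move=> x _; rewrite mulr_ge0 ?expR_ge0 ?ltW.
  - by rewrite mulr_ge0 ?powR_ge0 ?ltW.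
have {}yD : ~~ (0 < y).
  by apply: contra yD => y0; rewrite inE/= in_itv/= y0.
by apply: integral0_eq => x _; rewrite /h/= (negbTE yD).
Qed.

(** The substitution [x -> b x] is made for the exponent [s + 1], where the
    integrand extends continuously to 0; the recurrence, which holds for both
    rates, then brings the exponent back down to [s]. *)
Lemma gamma_integral_scale (R : realType) (b s : R) : 0 < b -> 0 < s ->
  gamma_integral b s = ((b `^ s)^-1%:E * gamma_integral 1 s)%E.
Proof.
move=> b0 s0.
suff key : gamma_integral 1 (s + 1) = ((b `^ (s + 1))%:E * gamma_integral b (s + 1))%E.
  move: key; rewrite (gamma_integral_recurrence ltr01 s0).
  rewrite (gamma_integral_recurrence b0 s0).
  move: (gamma_integral b s) (gamma_integral 1 s) => G G1.
  have bs0 : b `^ s != 0 by rewrite gt_eqF ?powR_gt0.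
  rewrite divr1 muleA -EFinM powRD ?(gt_eqF b0) ?implybT// powRr1 ?ltW// => key.
  have -> : G1 = (s^-1%:E * (s%:E * G1))%E.
    by rewrite muleA -EFinM mulVf ?gt_eqF// mul1e.
  rewrite key !muleA -!EFinM [X in X%:E](_ : _ = 1) ?mul1e//.
  by field; rewrite bs0 !gt_eqF.
have mk c : measurable_fun [set: measurableTypeR R] (fun x : R => x `^ s * expR (- c * x)).
  by rewrite -[in X in measurable_fun _ X](addrK 1 s); exact: measurable_gamma_kernel.
rewrite /gamma_integral addrK !integral_itv_obnd_cbnd; last 2 first.
- apply/measurable_EFinP/measurable_funTS; exact: mk.
- apply/measurable_EFinP/measurable_funTS; exact: mk.
have cp : {within `[0%R, +oo[%classic, continuous (fun x : R => x `^ s * expR (- 1 * x))}.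
  have ce : continuous (fun x : R => expR (- 1 * x)).
    by move=> x; apply: continuous_comp; [exact: mulrl_continuous|exact: continuous_expR].
  apply/continuous_within_itvcyP; split.
    move=> x; rewrite in_itv/= andbT => x0.
    apply: (@continuousM R R (@powR R ^~ s) (fun x => expR (- 1 * x))); last exact: ce.
    apply: differentiable_continuous; apply/derivable1_diffP.
    by apply: derivable_powR; rewrite in_itv/= x0.
  have cp0 : x `^ s @[x --> (0 : R)^'+] --> 0 `^ s.
    by rewrite powR0 ?gt_eqF//; exact: powR_cvg0.
  exact: (cvgM cp0 (cvg_at_right_filter (ce 0))).
have dFE : (( *%R b)^`())%classic = cst b :> (R -> R).
  apply/funext => x.
  by rewrite derive1E derive_val /GRing.scale/= mulr1.
rewrite -(ge0_integral_EFinZl (f := fun x : R => x `^ s * expR (- b * x))); last 4 first.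
- exact: measurable_itv.
- apply/measurable_funTS; exact: mk.
- by move=> x _; rewrite mulr_ge0 ?powR_ge0 ?expR_ge0.
- exact: powR_ge0.
have := @increasing_ge0_integration_by_substitutiony R ( *%R b)
  (fun x : R => x `^ s * expR (- 1 * x)) 0.
rewrite mulr0 => ->.
- apply: eq_integral => x; rewrite inE/= in_itv/= andbT => x0; congr EFin.
  rewrite !fctE dFE (powRM _ (ltW b0) x0) powRD ?(gt_eqF b0) ?implybT//.
  rewrite (powRr1 (ltW b0)).
  by rewrite mulN1r mulNr /=; ring.
- by move=> x y _ _; rewrite ltr_pM2l.
- by rewrite dFE => x _; exact: cst_continuous.
- by rewrite dFE; exact: is_cvg_cst.
- by rewrite dFE; exact: is_cvg_cst.
- split=> [x _|]; first exact: ex_derive.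
  by apply: cvg_at_right_filter; exact: mulrl_continuous.
- exact: gt0_cvgMry.
- exact: cp.
- by move=> x _; rewrite mulr_ge0 ?powR_ge0 ?expR_ge0.
Qed.

Lemma gamma_integral_addn (R : realType) (b s : R) (n : nat) : 0 < b -> 0 < s ->
  gamma_integral b (s + n%:R) =
    (((\prod_(i < n) (s + i%:R)) / b ^+ n)%:E * gamma_integral b s)%E.
Proof.
move=> b0 s0; elim: n => [|n IHn].
  by rewrite big_ord0 expr0 divr1 mul1e addr0.
have sn0 : 0 < s + n%:R by rewrite ltr_wpDr.
rewrite -natr1 addrA (gamma_integral_recurrence b0 sn0) IHn muleA -EFinM.
rewrite big_ord_recr/= exprS; congr (_%:E * _)%E.
by field; rewrite expf_neq0 gt_eqF.
Qed.

(** * The Poisson mixture of a gamma density *)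

Lemma Gamma_ge0 (R : realType) (s : R) : 0 <= Gamma s.
Proof. by apply: Rintegral_ge0 => x _; rewrite mulr_ge0 ?powR_ge0 ?expR_ge0. Qed.

Lemma measurable_gamma_pdf (R : realType) (s a : R) :
  measurable_fun [set: R] (gamma_pdf s a).
Proof.
apply/(measurable_restrictT (fun x => a `^ s / Gamma s * expR (- a * x) * x `^ (s - 1))).
  exact: measurable_itv.
rewrite [X in measurable_fun _ X](_ : _ =
  (fun x => a `^ s / Gamma s * (x `^ (s - 1) * expR (- a * x)))).
  apply: measurable_funM; first exact: measurable_cst.
  exact: measurable_gamma_kernel.
by apply/funext => x; rewrite -mulrA (mulrC (expR _)).
Qed.

Lemma gamma_pdf_total_mass (R : realType) (s a : R) :
  (\int[lebesgue_measure]_x (gamma_pdf s a x)%:E =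
   (a `^ s / Gamma s)%:E * gamma_integral a s)%E.
Proof.
rewrite /gamma_integral -ge0_integral_EFinZl; last 4 first.
- exact: measurable_itv.
- exact: measurable_gamma_kernel.
- by move=> x _; rewrite mulr_ge0 ?powR_ge0 ?expR_ge0.
- by rewrite mulr_ge0 ?invr_ge0 ?Gamma_ge0 ?powR_ge0.
rewrite [RHS]integral_mkcond; apply: eq_integral => x _.
rewrite /gamma_pdf !patchE; case: ifPn => [_|_ //].
by rewrite -mulrA (mulrC (expR _)).
Qed.

(** The hypothesis on the total mass stands in for the convergence of the
    integral defining [Gamma s] and for [Gamma s != 0]. *)
Lemma gamma_poisson_mixture (R : realType) (s a t : R) (n : nat) :
  0 < s -> 0 < a -> 0 <= t ->
  (\int[lebesgue_measure]_x (gamma_pdf s a x)%:E = 1)%E ->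
  (\int[lebesgue_measure]_(x in `]0%R, +oo[)
     ((poisson_mass (x * t) n)%:E * (gamma_pdf s a x)%:E) =
   (rising_binom s n * (a / (a + t)) `^ s * (t / (a + t)) ^+ n)%:E)%E.
Proof.
move=> s0 a0 t0 mass1; have at0 : 0 < a + t by rewrite ltr_wpDr.
set c := a `^ s / Gamma s.
have c0 : 0 <= c by rewrite mulr_ge0 ?invr_ge0 ?Gamma_ge0 ?powR_ge0.
have as0 : a `^ s != 0 by rewrite gt_eqF ?powR_gt0.
have cI : (c%:E * gamma_integral 1 s = (a `^ s)%:E)%E.
  move: mass1; rewrite gamma_pdf_total_mass (gamma_integral_scale a0 s0) -/c.
  move: (gamma_integral 1 s) => G mass1.
  rewrite -[RHS]mule1 -mass1 [RHS]muleCA; congr (_ * _)%E.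
  by rewrite muleA -EFinM mulfV// mul1e.
have k0 : 0 <= c * (t ^+ n / n`!%:R).
  by rewrite mulr_ge0 // mulr_ge0 ?invr_ge0 ?exprn_ge0.
transitivity ((c * (t ^+ n / n`!%:R))%:E * gamma_integral (a + t) (s + n%:R))%E.
  rewrite /gamma_integral -ge0_integral_EFinZl; last 4 first.
  - exact: measurable_itv.
  - exact: measurable_gamma_kernel.
  - by move=> x _; rewrite mulr_ge0 ?powR_ge0 ?expR_ge0.
  - exact: k0.
  apply: eq_integral => x xD; rewrite /gamma_pdf patchE xD.
  have x0 : 0 < x by move: xD; rewrite inE/= in_itv/= andbT.
  rewrite -EFinM; congr EFin; rewrite /poisson_mass -/c.
  rewrite addrAC (@powRD _ x (s - 1) n%:R) ?(gt_eqF x0) ?implybT//.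
  rewrite (powR_mulrn _ (ltW x0)) exprMn.
  have -> : - (a + t) * x = - a * x + - (x * t) by ring.
  by rewrite expRD; ring.
rewrite (gamma_integral_addn _ at0 s0) (gamma_integral_scale at0 s0).
move: (gamma_integral 1 s) cI => G cI; rewrite !muleA -!EFinM.
rewrite [X in (X%:E * _)%E](_ : _ = (\prod_(i < n) (s + i%:R)) / n`!%:R * ((a + t) `^ s)^-1 *
    (t / (a + t)) ^+ n * c); last first.
  rewrite expr_div_n; move: ((a + t) ^+ n)^-1 (n`!%:R)^-1 ((a + t) `^ s)^-1 => u v w.
  by ring.
rewrite EFinM -muleA cI -EFinM; congr EFin.
rewrite /rising_binom powRM ?invr_ge0 ?(ltW a0) ?(ltW at0)//.
have -> : (a + t)^-1 `^ s = ((a + t) `^ s)^-1.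
  by rewrite -powR_inv1 ?(ltW at0)// -powRrM mulN1r powRN.
by ring.
Qed.

(** * Integration against the law of a random variable *)

Lemma measure_eq_ae (d : measure_display) (T : measurableType d) (R : realType)
    (mu : {measure set T -> \bar R}) (A B : set T) :
  measurable A -> measurable B -> {ae mu, forall w, A w <-> B w} -> mu A = mu B.
Proof.
move=> mA mB AB.
rewrite -[A]setIT -[B]setIT -(integral_indic mu measurableT mA).
rewrite -(integral_indic mu measurableT mB).
apply: ge0_ae_eq_integral.
- exact: measurableT.
- by apply/measurable_EFinP; exact: measurable_indic.
- by apply/measurable_EFinP; exact: measurable_indic.
- by move=> w _; rewrite lee_fin indicE ler0n.
- by move=> w _; rewrite lee_fin indicE ler0n.
- apply: filterS AB => w ABw _; congr EFin; rewrite !indicE; congr (_ %:R).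
  by congr nat_of_bool; apply/idP/idP; rewrite !inE => /ABw.
Qed.

(** A density that represents [nu] on all measurable sets agrees almost
    everywhere with the Radon-Nikodym derivative, for which the change of
    variables is known. *)
Lemma ge0_integral_density (d : measure_display) (T : measurableType d)
    (R : realType) (nu : {finite_measure set T -> \bar R})
    (mu : {sigma_finite_measure set T -> \bar R}) (p f : T -> \bar R) (E : set T) :
  measurable_fun [set: T] p ->
  (forall A, measurable A -> nu A = \int[mu]_(x in A) p x)%E ->
  measurable E -> measurable_fun E f -> (forall x, E x -> 0 <= f x)%E ->
  (\int[nu]_(x in E) f x = \int[mu]_(x in E) (f x * p x))%E.
Proof.
move=> mp nuE mE mf f0.
have numu : nu `<< mu.
  apply/null_content_dominatesP => A mA muA0; rewrite nuE// null_set_integral//.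
  exact: measurable_funTS.
have fi := Radon_Nikodym_SigmaFinite.f_integrable numu.
(* The Radon-Nikodym change of variables wants an integrand that is nonnegative
   everywhere, so [f] is replaced by its extension by 0 outside [E]. *)
have fE x : x \in E -> f x = (f \_ E) x by move=> xE; rewrite patchE xE.
under eq_integral do rewrite fE//; under [RHS]eq_integral do rewrite fE//.
have {}f0 x : (0 <= (f \_ E) x)%E by exact: erestrict_ge0.
have {}mf : measurable_fun E (f \_ E).
  by apply: measurable_funTS; exact/(measurable_restrictT f).
rewrite -(Radon_Nikodym_SigmaFinite.change_of_variables numu)//.
apply: ae_eq_integral => //.
- apply: emeasurable_funM => //; apply: measurable_funTS; exact: measurable_int fi.
- by apply: emeasurable_funM => //; apply: measurable_funTS.
- apply: ae_eqe_mul2l; apply: integral_ae_eq => //.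
  + exact: integrableS fi.
  + exact: measurable_funTS.
  + by move=> A _ mA; rewrite -Radon_Nikodym_SigmaFinite.f_integral// nuE.
Qed.

Lemma ge0_integral_comp_density (d : measure_display) (T : measurableType d)
    (R : realType) (P : probability T R) (Y : {RV P >-> R}) (p f : R -> R) (D : set R) :
  measurable_fun [set: R] p ->
  (forall B : set R, measurable B ->
    distribution P Y B = \int[lebesgue_measure]_(x in B) (p x)%:E)%E ->
  measurable D -> measurable_fun D f -> (forall x, D x -> 0 <= f x) ->
  (\int[P]_(w in Y @^-1` D) (f (Y w))%:E =
   \int[lebesgue_measure]_(x in D) ((f x)%:E * (p x)%:E))%E.
Proof.
move=> mp lawY mD mf f0.
(* Lebesgue measure lives on the Borel structure generated by half-open
   intervals, which has the same measurable sets as [R] under another display;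
   [Y'] is [Y] with values in that structure. *)
have mY : measurable_fun [set: T] (Y : T -> measurableTypeR R).
  exact: (measurable_funP Y).
pose Y' : {RV P >-> measurableTypeR R} :=
  HB.pack (Y : T -> measurableTypeR R) (isMeasurableFun.Build _ _ _ _ _ mY).
have mf' : measurable_fun (D : set (measurableTypeR R)) (EFin \o f).
  exact/measurable_EFinP.
have f0' x : D x -> (0 <= (EFin \o f) x)%E by move=> Dx; rewrite lee_fin f0.
have dens := @ge0_integral_density _ (measurableTypeR R) R
  (distribution P Y') lebesgue_measure (EFin \o p) (EFin \o f) D.
rewrite -[RHS]dens.
- apply/esym; apply: (ge0_integral_pushforward (phi := Y')).
  + exact: mY.
  + exact: mD.
  + exact: mf'.
  + by move=> x /[!inE]; exact: f0'.
- exact/measurable_EFinP.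
- exact: lawY.
- exact: mD.
- exact: mf'.
- exact: f0'.
Qed.

(** * The law of the mixed process *)

Lemma gamma_distributed_gt0 (d : measure_display) (T : measurableType d)
    (R : realType) (P : probability T R) (s a : R) (Y : {RV P >-> R}) :
  gamma_distributed s a Y -> {ae P, forall w, 0 < Y w}.
Proof.
move=> hY; exists (Y @^-1` `]-oo, 0%R]); split.
- by rewrite -[X in measurable X]setTI; exact: measurable_funP.
- have := hY `]-oo, 0%R]%classic (measurable_itv _).
  rewrite /distribution/= /pushforward => ->; apply: integral0_eq => x.
  rewrite /= in_itv/= => x0; rewrite /gamma_pdf patchE memNset//=.
  by rewrite in_itv/= andbT; apply/negP; rewrite -leNgt.
- by move=> w /= /negP; rewrite -leNgt in_itv.
Qed.

(** The conditional law is only given for increments over nondegenerate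
    intervals, so for [t > 0] the event [X t = n] is replaced by the increment
    event [X t = X 0 + n], which differs from it by a null set.  The rate is
    also restricted to the positive half-line, which has full measure, because
    the Poisson mass may be negative elsewhere. *)
Lemma mixed_poisson_pmf (d : measure_display) (T : measurableType d) (R : realType)
    (P : probability T R) (s a : R) (lam : {RV P >-> R}) (X : R -> {RV P >-> nat})
    (t : R) (n : nat) :
  0 < s -> 0 < a -> gamma_distributed s a lam -> cond_poisson_process lam X ->
  0 <= t ->
  P [set w | X t w = n] =
    (rising_binom s n * (a / (a + t)) `^ s * (t / (a + t)) ^+ n)%:E.
Proof.
move=> s0 a0 hlam [X0 _ _ hX].
have mX (u : R) (m : nat) : measurable [set w | X u w = m].
  rewrite -[X in measurable X]setTI.
  exact: (measurable_funP (X u) measurableT [set m]).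
rewrite le_eqVlt => /predU1P[<-|t0].
  rewrite addr0 divff ?gt_eqF// powR1 mul0r mulr1.
  have [->|n0] := eqVneq n 0%N.
    rewrite expr0 mulr1 /rising_binom big_ord0 fact0 divr1.
    rewrite -(probability_setT P); apply: measure_eq_ae => //.
    by apply: filterS X0.
  rewrite expr0n (negbTE n0) mulr0.
  transitivity (P set0); last by rewrite measure0.
  apply: measure_eq_ae => //.
  by apply: filterS X0 => w /= ->; split => // /esym/eqP; rewrite (negbTE n0).
have [mg hg] : cond_prob lam [set w | X t w = (X 0%R w + n)%N]
    (fun l => poisson_mass (l * t) n).
  have := hX 1%N (fun i => t *+ i) (fun=> n) (lexx _).
  have /[swap]/[apply] : forall i, (i < 1)%N -> t *+ i < t *+ i.+1.
    by move=> [|]// _; rewrite mulr0n mulr1n.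
  congr (cond_prob _ _ _).
    apply/seteqP; split => w /=.
      by move=> /(_ 0%N isT); rewrite mulr0n mulr1n.
    by move=> h [|]// _; rewrite mulr0n mulr1n.
  by apply/funext => l; rewrite big_ord1 mulr0n mulr1n subr0.
pose D : set R := `]0, +oo[%classic.
have mD : measurable D by exact: measurable_itv.
transitivity (P ([set w | X t w = (X 0%R w + n)%N] `&` lam @^-1` D)).
  apply: measure_eq_ae.
  - exact: mX.
  - apply: measurableI.
      rewrite (_ : mkset _ = \bigcup_m
          ([set w | X t w = (m + n)%N] `&` [set w | X 0%R w = m])).
        by apply: bigcupT_measurable => m; apply: measurableI; exact: mX.
      apply/seteqP; split => [w /= Xw|w [m _ /= [-> ->]] //].
      by exists (X 0%R w).
    rewrite -[X in measurable X]setTI; exact: (measurable_funP lam).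
  - apply: filterS2 X0 (gamma_distributed_gt0 hlam) => w /= -> lam0.
    by rewrite add0n /D /= in_itv/= lam0; split => // -[].
rewrite (hg D mD) -(gamma_poisson_mixture _ s0 a0 (ltW t0)); last first.
  by rewrite -(hlam setT measurableT); exact: probability_setT.
have pm0 x : D x -> 0 <= poisson_mass (x * t) n.
  rewrite /D/= in_itv/= andbT => x0.
  have xt : 0 <= x * t by rewrite mulr_ge0 ?ltW.
  by rewrite /poisson_mass !mulr_ge0 ?expR_ge0 ?exprn_ge0 ?invr_ge0.
apply: (ge0_integral_comp_density (f := fun x => poisson_mass (x * t) n)).
- exact: measurable_gamma_pdf.
- exact: hlam.
- exact: mD.
- exact: measurable_funTS.
- exact: pm0.
Qed.

Theorem theorem2 (d : measure_display) (T : measurableType d) (R : realType)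
    (P : probability T R) (k : nat) (a : R)
    (lam : {RV P >-> R}) (X : R -> {RV P >-> nat}) (Z : R -> T -> nat)
    (hk : (1 <= k)%N) (ha : 0 < a)
    (hlam : gamma_distributed k%:R^-1 a lam)
    (hX : cond_poisson_process lam X)
    (hZ : forall t w, 0 <= t -> Z t w = (k * X t w + 1)%N) :
  forall t : R, 0 <= t ->
    (0 < t -> harris P ((a + t) / a) k (Z t)) /\
    (forall n : nat,
      P [set w | Z t w = (n * k + 1)%N] =
        (rising_binom k%:R^-1 n * (a / (a + t)) `^ k%:R^-1
           * (t / (a + t)) ^+ n)%:E).
Proof.
move=> t t0.
have s0 : 0 < k%:R^-1 :> R by rewrite invr_gt0 ltr0n.
have at0 : 0 < a + t by rewrite ltr_wpDr.
have law n : P [set w | Z t w = (n * k + 1)%N] =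
    (rising_binom k%:R^-1 n * (a / (a + t)) `^ k%:R^-1 * (t / (a + t)) ^+ n)%:E.
  rewrite -(mixed_poisson_pmf n s0 ha hlam hX t0).
  congr (P _); apply/seteqP; split => w /=; rewrite hZ//.
    by move=> /addIn; rewrite mulnC => /eqP; rewrite eqn_pmul2r// => /eqP.
  by move=> ->; rewrite mulnC.
split; last exact: law.
move=> t_gt0; split.
- exact: hk.
- by rewrite ltr_pdivlMr// mul1r ltrDl.
- rewrite (_ : Z t = (fun x => (k * x + 1)%N) \o X t); last first.
    by apply/funext => w /=; rewrite hZ.
  by apply: measurableT_comp => //; exact: measurable_funP.
- move=> n; rewrite addnC law invf_div.
  rewrite (_ : 1 - a / (a + t) = t / (a + t))//.
  by field; rewrite gt_eqF.
Qed.
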